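(* Let $(U,\mathcal{F},\kappa)$ be an instance of \textsc{Hitting Set} with $|U|=n$ and $0\le\kappa\le n$. Construct a graph $G$ as follows: its vertices are $m_F$ for each $F\in\mathcal{F}$, $v_u$ for each $u\in U$ (let $Q_1=\{v_u:u\in U\}$), a set $Q_2$ of $n-\kappa$ further vertices, and two vertices $m_1,m_2$. Its edges: $Q_1$ is a clique, $Q_2$ is a clique, $m_1$ and $m_2$ are adjacent to each other and to all vertices of $Q_1\cup Q_2$, and for each $F\in\mathcal{F}$, $N_G(m_F)=\{v_u:u\in F\}$; there are no other edges. Let $\ell=n+2$. Then $(U,\mathcal{F},\kappa)$ is a yes-instance of \textsc{Hitting Set} if and only if $(G,\ell)$ is a yes-instance of \textsc{Dominator Coloring}.
   Context: \textsc{Hitting Set}: given a finite set $U$, a family $\mathcal{F}$ of subsets of $U$ and an integer $\kappa$, decide whether there is $S\subseteq U$ with $|S|\le\kappa$ and $S\cap F\neq\emptyset$ for all $F\in\mathcal{F}$. A dominator coloring of $G$ is a proper coloring in which every vertex $v$ dominates some color class (the class is contained in $N_G[v]=N_G(v)\cup\{v\}$). \textsc{Dominator Coloring}: given $(G,\ell)$, decide whether $G$ has a dominator coloring with at most $\ell$ colors. *)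

(* Defs.v *)
From HB Require Import structures.
From mathcomp Require Import all_boot.

Set Implicit Arguments.
Unset Strict Implicit.
Unset Printing Implicit Defensive.

Record sgraph := SGraph {
  vertex :> finType;
  adj : rel vertex;
  adj_sym : symmetric adj;
  adj_irrefl : irreflexive adj }.

Section DominatorColoring.
Variable G : sgraph.

Definition open_nbhd (v : G) : {set G} := [set w | adj v w].
Definition closed_nbhd (v : G) : {set G} := v |: open_nbhd v.

(* Colors are natural numbers; only the colors in the image of a coloring
   count, so that color classes are nonempty. *)
Definition proper_coloring (c : G -> nat) : Prop :=
  forall v w : G, adj v w -> c v <> c w.

Definition colors (c : G -> nat) : seq nat := undup (codom c).

Definition color_class (c : G -> nat) (i : nat) : {set G} := [set v | c v == i].

Definition dominates (v : G) (A : {set G}) : bool := A \subset closed_nbhd v.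

Definition dominator_coloring (c : G -> nat) : Prop :=
  proper_coloring c /\
  forall v : G, exists2 i, i \in colors c & dominates v (color_class c i).

Definition dominator_coloring_yes (l : nat) : Prop :=
  exists c : G -> nat, dominator_coloring c /\ size (colors c) <= l.

End DominatorColoring.

Definition hitting_set_yes (U : finType) (Fam : {set {set U}}) (k : nat) : Prop :=
  exists S : {set U},
    #|S| <= k /\ forall F : {set U}, F \in Fam -> S :&: F != set0.

Section Reduction.
Variables (U : finType) (Fam : {set {set U}}) (k : nat).

(* [setV F] is m_F, [eltV u] is v_u (these form Q_1), the [padV i] form Q_2,
   and [hubV false], [hubV true] are m_1, m_2. *)
Inductive red_vertex :=
  | setV of {F : {set U} | F \in Fam}
  | eltV of U
  | padV of 'I_(#|U| - k)
  | hubV of bool.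

Definition red_vertex_code (x : red_vertex) :
    {F : {set U} | F \in Fam} + U + 'I_(#|U| - k) + bool :=
  match x with
  | setV F => inl (inl (inl F))
  | eltV u => inl (inl (inr u))
  | padV i => inl (inr i)
  | hubV b => inr b
  end.

Definition red_vertex_decode
    (s : {F : {set U} | F \in Fam} + U + 'I_(#|U| - k) + bool) : red_vertex :=
  match s with
  | inl (inl (inl F)) => setV F
  | inl (inl (inr u)) => eltV u
  | inl (inr i) => padV i
  | inr b => hubV b
  end.

Lemma red_vertex_codeK : cancel red_vertex_code red_vertex_decode.
Proof. by case. Qed.

HB.instance Definition _ := Finite.copy red_vertex (can_type red_vertex_codeK).

Definition red_adj (x y : red_vertex) : bool :=
  match x, y with
  | setV F, eltV u | eltV u, setV F => u \in val F
  | eltV u, eltV w => u != w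
  | padV i, padV j => i != j
  | hubV a, hubV b => a != b
  | hubV _, (eltV _ | padV _) | (eltV _ | padV _), hubV _ => true
  | _, _ => false
  end.

Lemma red_adj_sym : symmetric red_adj.
Proof. by case=> [F|u|i|a] [F'|w|j|b] //=; rewrite eq_sym. Qed.

Lemma red_adj_irrefl : irreflexive red_adj.
Proof. by case=> [F|u|i|a] //=; rewrite eqxx. Qed.

Definition red_graph : sgraph := SGraph red_adj_sym red_adj_irrefl.

End Reduction.

(* Main.v *)
Require Import Defs.
From mathcomp Require Import all_boot.

(** Given a hitting set [S], give the clique Q_1 + {m_1, m_2} pairwise distinct
    colors, reuse on Q_2 the colors of elements outside [S], and give every m_F
    the color of m_1. The class of m_2 is then a singleton dominated by
    everything but the m_F, and m_F dominates the singleton class of v_u for any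
    [u] in [S] and F. Conversely, the clique already uses all n + 2 colors, so
    Q_2 repeats n - k colors of Q_1; the elements whose colors are not repeated
    are the hitting set. *)

Set Implicit Arguments.
Unset Strict Implicit.
Unset Printing Implicit Defensive.

Lemma enum_rank_neq (T : finType) (x : T) n :
  #|T| <= n -> enum_rank x <> n :> nat.
Proof.
by move=> le_n e; have := ltn_ord (enum_rank x); rewrite e ltnNge le_n.
Qed.

Section Reduction.
Variables (U : finType) (Fam : {set {set U}}) (k : nat).

Local Notation G := (red_graph Fam k).
Local Notation elt := (@eltV U Fam k : U -> G).
Local Notation pad := (@padV U Fam k : _ -> G).
Local Notation hub := (@hubV U Fam k : bool -> G).

Section ColoringOfHittingSet.
Variables (S : {set U}) (cS : #|U| - k <= #|~: S|).

Definition hitting_coloring (x : G) : nat :=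
  match x with
  | setV _ => #|U|
  | eltV u => enum_rank u
  | padV i => enum_rank (enum_val (widen_ord cS i))
  | hubV b => #|U| + b
  end.

Lemma hitting_coloring_proper : proper_coloring hitting_coloring.
Proof.
have rankN0 (u : U) := @enum_rank_neq U u _ (leqnn _).
have rankN (u : U) b := @enum_rank_neq U u _ (leq_addr b _).
case=> [F|u|i|a] [F'|w|j|b] //= a_vw;
  try by [move/rankN0 | move/rankN | move/esym/rankN0 | move/esym/rankN].
- by move/ord_inj/enum_rank_inj=> e; rewrite e eqxx in a_vw.
- move/ord_inj/enum_rank_inj/enum_val_inj/(congr1 val) => /= /ord_inj e.
  by rewrite e eqxx in a_vw.
- by move/addnI; case: a b a_vw => [] [].
Qed.

Lemma hitting_coloring_size : size (colors hitting_coloring) <= #|U| + 2.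
Proof.
rewrite -(size_iota 0 (#|U| + 2)); apply: uniq_leq_size (undup_uniq _) _ => i.
rewrite mem_undup => /codomP [x ->]; rewrite mem_iota /= add0n.
case: x => [F|u|j|b] /=; try exact: ltn_addr (ltn_ord _).
- by rewrite -[X in X < _]addn0 ltn_add2l.
- by rewrite ltn_add2l; case: b.
Qed.

Lemma hitting_coloring_dominator :
  (forall F : {set U}, F \in Fam -> S :&: F != set0) ->
  dominator_coloring hitting_coloring.
Proof.
move=> hitS; split; first exact: hitting_coloring_proper.
have memc x : hitting_coloring x \in colors hitting_coloring.
  by rewrite mem_undup codom_f.
have hub_class x : hitting_coloring x = #|U| + 1 -> x = hub true.
  case: x => [F|u|i|[]] //=;
    try by move/(enum_rank_neq (leq_addr _ _)).
  - by move/eqP; rewrite -{1}[#|U|]addn0 eqn_add2l.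
  - by move/eqP; rewrite eqn_add2l.
have dom_hub v : hub true \in closed_nbhd v ->
    exists2 i, i \in colors hitting_coloring
      & dominates v (color_class hitting_coloring i).
  move=> vh; exists (hitting_coloring (hub true)); first exact: memc.
  by apply/subsetP=> x; rewrite inE => /eqP /hub_class ->.
case=> [[F FF]|u|i|b]; try by apply: dom_hub; rewrite !inE ?eqxx ?orbT.
- have /set0Pn [u /setIP [uS uF]] := hitS F FF.
  exists (hitting_coloring (elt u)); first exact: memc.
  apply/subsetP=> -[F'|w|i|b]; rewrite inE /= => /eqP.
  + by move/esym/(enum_rank_neq (leqnn _)).
  + by move/ord_inj/enum_rank_inj->; rewrite !inE [adj _ _]uF orbT.
  + move/ord_inj/enum_rank_inj=> e.
    by have := enum_valP (widen_ord cS i); rewrite e inE uS.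
  + by move/esym/(enum_rank_neq (leq_addr _ _)).
- by apply: dom_hub; rewrite !inE /=; case: b; rewrite ?eqxx ?orbT.
Qed.

End ColoringOfHittingSet.

Section HittingSetOfColoring.
Variables (c : G -> nat).
Hypotheses (c_proper : proper_coloring c) (c_size : size (colors c) <= #|U| + 2).

Definition core : seq G := [seq elt u | u <- enum U] ++ [:: hub false; hub true].

Lemma mem_core (x : G) :
  (x \in core) = match x with eltV _ | hubV _ => true | _ => false end.
Proof.
have elt_inj : injective elt by move=> u w [].
rewrite mem_cat !inE; case: x => [F|u|i|b].
- by rewrite !orbF; apply/mapP => -[].
- by rewrite (mem_map elt_inj) mem_enum.
- by rewrite !orbF; apply/mapP => -[].
- by case: b; rewrite eqxx !orbT.
Qed.

Lemma core_color_inj : {in core &, injective c}.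
Proof.
move=> x y; rewrite !mem_core.
case: x y => [?|u|?|a] // [?|w|?|b] // _ _ e.
- by case: (eqVneq u w) => [-> //|uw]; case: (c_proper (v := elt u) (w := elt w)).
- by case: (c_proper (v := elt u) (w := hub b)).
- by case: (c_proper (v := hub a) (w := elt w)).
- by case: (eqVneq a b) => [-> //|ab]; case: (c_proper (v := hub a) (w := hub b)).
Qed.

Lemma core_color_surj x : exists2 y, y \in core & c y = c x.
Proof.
have core_uniq : uniq core.
  have elt_inj : injective elt by move=> u w [].
  rewrite cat_uniq (map_inj_uniq elt_inj) enum_uniq /= andbT orbF.
  by apply/norP; split; apply/mapP => -[].
have [|i||_ eq_core] := uniq_min_size (s1 := map c core) (s2 := colors c).
- by rewrite (map_inj_in_uniq core_color_inj).
- by case/mapP=> y _ ->; rewrite mem_undup codom_f.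
- by rewrite size_map size_cat size_map -cardE.
have : c x \in map c core by rewrite eq_core mem_undup codom_f.
by case/mapP=> y y_core ->; exists y.
Qed.

Definition unrepeated : {set U} := [set u | [forall i, c (pad i) != c (elt u)]].

Lemma pad_color i : exists u, c (elt u) = c (pad i).
Proof.
have [y] := core_color_surj (pad i); rewrite mem_core.
case: y => [?|u|?|b] // _ e; first by exists u.
by case: (c_proper (v := hub b) (w := pad i)).
Qed.

Lemma card_unrepeated : #|unrepeated| <= k.
Proof.
suff : #|U| - k <= #|~: unrepeated|.
  by rewrite leq_subLR -(cardsC unrepeated) leq_add2r.
have ex_f i : exists u, c (elt u) == c (pad i).
  by have [u e] := pad_color i; exists u; apply/eqP.
pose f i := xchoose (ex_f i).
have f_color i : c (elt (f i)) = c (pad i) by apply/eqP/(xchooseP (ex_f i)).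
have f_inj : injective f.
  move=> i j e; have := f_color i; rewrite e f_color => {}e.
  by case: (eqVneq i j) => // ij; case: (c_proper (v := pad i) (w := pad j)).
rewrite -[X in X <= _]card_ord -(card_codom f_inj).
apply: subset_leq_card.
apply/subsetP=> _ /codomP [i ->]; rewrite !inE negb_forall.
by apply/existsP; exists i; rewrite negbK f_color.
Qed.

Lemma unrepeated_hits (F : {set U}) (FF : F \in Fam) i :
  i \in colors c ->
  dominates (setV k (exist _ F FF) : G) (color_class c i) ->
  unrepeated :&: F != set0.
Proof.
rewrite mem_undup => /codomP [x ->] /subsetP dom.
have [y] := core_color_surj x; rewrite mem_core => + yx.
have := dom y; rewrite !inE yx eqxx => /(_ isT).
case: y yx => [?|u|?|b] // ux uF _; apply/set0Pn; exists u.
rewrite !inE [u \in F]uF andbT; apply/forallP => j; apply/eqP => ju.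
by have := dom (pad j); rewrite !inE ju ux eqxx => /(_ isT).
Qed.

End HittingSetOfColoring.
End Reduction.

Theorem theorem17 (U : finType) (Fam : {set {set U}}) (k : nat)
    (hk : k <= #|U|) :
  hitting_set_yes Fam k <->
  dominator_coloring_yes (red_graph Fam k) (#|U| + 2).
Proof.
split=> [[S [Sk hitS]]|[c [[c_proper c_dom] c_size]]].
- have cS : #|U| - k <= #|~: S| by rewrite -(cardsC S) leq_subLR leq_add2r.
  exists (@hitting_coloring _ Fam _ _ cS); split; last exact: hitting_coloring_size.
  exact: hitting_coloring_dominator.
- exists (unrepeated c); split; first exact: card_unrepeated.
  move=> F FF; have [i] := c_dom (setV k (exist _ F FF)).
  exact: unrepeated_hits.
Qed.
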